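(* Fix a nonnegative integer $m$ and a quantity $y$ (e.g. an indeterminate). For nonnegative integers $u,d\ge m$ define $$L(u,d;m,y)=\sum_{\ell=0}^{d-m}\binom{d-m}{\ell}\prod_{i=0}^{\ell-1}(m+i+1-r)(i+r)\prod_{j=\ell+1}^{d-m}(y+d-m+r-j)(y+u+r+j)$$ and $$\tilde L(u,d)=\frac{L(u,d;m,y)}{\prod_{i=1}^{d-m}(y+m+i)(y+i-1+2r)}.$$ Then for all nonnegative integers $u,d\ge m$ we have $\tilde L(u,d)=\tilde L(d,u)$.
   Context: $r$ is an indeterminate (in the paper $r=1/\alpha$ where $\alpha$ is the Jack parameter); the identity is one of rational functions in $r$ (and $y$). *)

(* Defs.v *)
From HB Require Import structures.
From mathcomp Require Import all_boot all_order all_algebra.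

Set Implicit Arguments.
Unset Strict Implicit.
Unset Printing Implicit Defensive.

Import GRing.Theory.
Local Open Scope ring_scope.

(* The natural subtraction [d - m] is only meant for [m <= d]. *)
Definition Lsum (F : fieldType) (r y : F) (m u d : nat) : F :=
  \sum_(0 <= l < (d - m).+1)
    'C(d - m, l)%:R
    * (\prod_(0 <= i < l) ((m%:R + i%:R + 1 - r) * (i%:R + r)))
    * (\prod_(l.+1 <= j < (d - m).+1)
         ((y + d%:R - m%:R + r - j%:R) * (y + u%:R + r + j%:R))).

Definition Lden (F : fieldType) (r y : F) (m d : nat) : F :=
  \prod_(1 <= i < (d - m).+1)
    ((y + m%:R + i%:R) * (y + i%:R - 1 + 2%:R * r)).

Definition Ltilde (F : fieldType) (r y : F) (m u d : nat) : F :=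
  Lsum r y m u d / Lden r y m d.

(* The field Q(r, y), as the fractions of Q[y][r]. *)
Definition ratfun : fieldType := {fraction {poly {poly rat}}}.

Definition r_var : ratfun := tofrac ('X : {poly {poly rat}}).
Definition y_var : ratfun := tofrac (('X : {poly rat})%:P).

(* Main.v *)
Require Import Defs.
From HB Require Import structures.
From mathcomp Require Import all_boot all_order all_algebra.
From mathcomp Require Import ring.

Set Implicit Arguments.
Unset Strict Implicit.
Unset Printing Implicit Defensive.

Import GRing.Theory.
Local Open Scope ring_scope.

(** Put D = d - m, U = u - m, a = r, b = m + 1 - r, c = y + r, e = a + b + c + U.
    In terms of rising factorials (x)_n the numerator is
      sum_l C(D,l) (a)_l (b)_l (c)_(D-l) (e+l)_(D-l),
    a terminating 3F2(1), and the denominator is (c+a)_D (c+b)_D.  Two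
    applications of Sheppard's 3F2 transformation turn the numerator into
      sum_k C(D,k) (-U)_k (a)_k (c+a+k)_(D-k) (c+b+U)_(D-k),
    and multiplying this by (c+a)_U (c+b)_U gives an expression whose k-th term
    is visibly symmetric in U and D.  The transformation is proved directly, by
    induction on D: both sides satisfy
      T_(D+1)(a,b,c,e) = c (e+D) T_D(a,b,c+1,e) + a b T_D(a+1,b+1,c,e+1). *)

Section RisingFactorial.
Variable R : comNzRingType.
Implicit Types (x a b c e : R) (n k : nat).

Definition rising x n : R := \prod_(0 <= i < n) (x + i%:R).

Lemma rising0 x : rising x 0 = 1.
Proof. by rewrite /rising big_geq. Qed.

Lemma risingSr x n : rising x n.+1 = rising x n * (x + n%:R).
Proof. by rewrite /rising big_nat_recr. Qed.

Lemma risingD x n k : rising x (n + k) = rising x n * rising (x + n%:R) k.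
Proof.
elim: k => [|k IH]; first by rewrite addn0 rising0 mulr1.
by rewrite addnS !risingSr IH natrD; ring.
Qed.

Lemma risingSl x n : rising x n.+1 = x * rising (x + 1) n.
Proof. by rewrite -add1n risingD risingSr rising0 mul1r addr0. Qed.

Lemma rising_sub1 x n :
  rising x n = rising (x + 1) n - n%:R * rising (x + 1) n.-1.
Proof.
(* At [n = 0] the default value [0.-1 = 0] is harmless, since its term carries the factor 0. *)
case: n => [|n]; first by rewrite !rising0 mul0r subr0.
by rewrite risingSl risingSr /= -natr1; ring.
Qed.

Lemma rising_oppn n k : rising (- n%:R) k = (-1) ^+ k * (n ^_ k)%:R.
Proof.
elim: k => [|k IH]; first by rewrite rising0 expr0 mul1r ffactn0.
rewrite risingSr IH ffactnSr natrM exprS.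
case: (leqP k n) => [le_kn|lt_nk]; first by rewrite natrB //; ring.
by rewrite ffact_small // !mul0r !mulr0 mul0r.
Qed.

Lemma sum_bin_pascal n (f : nat -> R) :
  \sum_(l < n.+2) 'C(n.+1, l)%:R * f l
  = \sum_(l < n.+1) 'C(n, l)%:R * (f l + f l.+1).
Proof.
rewrite big_ord_recl /= bin0.
under eq_bigr => i _ do rewrite /bump /= add1n binS natrD mulrDl.
rewrite big_split /=.
under [RHS]eq_bigr => i _ do rewrite mulrDr.
rewrite [RHS]big_split /= addrA; congr (_ + _).
rewrite [RHS]big_ord_recl [X in _ + X]big_ord_recr /= bin0.
by rewrite bin_small // mul0r addr0.
Qed.

(** Absorption, (k+1) C(n,k+1) = (n-k) C(n,k), after shifting the index by one; the term k = 0 on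
    the left and the term k = n on the right vanish. *)
Lemma sum_bin_shift n (g : nat -> R) :
  \sum_(k < n.+1) 'C(n, k)%:R * (k%:R * g k)
  = \sum_(k < n.+1) 'C(n, k)%:R * ((n%:R - k%:R) * g k.+1).
Proof.
rewrite big_ord_recl /= mul0r mulr0 add0r.
rewrite [RHS]big_ord_recr /= subrr mul0r mulr0 addr0.
apply: eq_bigr => i _; rewrite /bump /= add1n !mulrA; congr (_ * _).
have le_in : (i <= n)%N by rewrite ltnW.
by rewrite -natrB // -!natrM mulnC mul_bin_left mulnC.
Qed.

Definition sheppard_lhs n a b c e : R :=
  \sum_(l < n.+1) 'C(n, l)%:R *
    (rising a l * rising b l * rising c (n - l) * rising (e + l%:R) (n - l)).

Definition sheppard_rhs n a b c e : R :=
  \sum_(k < n.+1) 'C(n, k)%:R *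
    (rising (a + b + c - e) k * rising a k * rising (c + a + k%:R) (n - k)
     * rising (e - a) (n - k)).

(** Pascal's rule splits the sum so that the recurrence holds term by term: the l-th term gives up c
    and the last factor e + n, the (l+1)-st gives up a and b. *)
Lemma sheppard_lhsS n a b c e :
  sheppard_lhs n.+1 a b c e =
  c * (e + n%:R) * sheppard_lhs n a b (c + 1) e
  + a * b * sheppard_lhs n (a + 1) (b + 1) c (e + 1).
Proof.
rewrite /sheppard_lhs (sum_bin_pascal n (fun l => rising a l * rising b l *
  rising c (n.+1 - l) * rising (e + l%:R) (n.+1 - l))).
rewrite !big_distrr -big_split /=; apply: eq_bigr => -[k /= lt_kn] _.
have le_kn : (k <= n)%N by [].
rewrite subSS subSn // risingSl (risingSl a) (risingSl b).
rewrite (risingSr (e + _)) natrB // -natr1.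
by rewrite (_ : e + (k%:R + 1) = e + 1 + k%:R); ring.
Qed.

(* The shift (v)_k = (v+1)_k - k (v+1)_(k-1), with the resulting sum
   reindexed, makes the recurrence hold term by term. *)
Lemma sheppard_rhsS n a b c e :
  sheppard_rhs n.+1 a b c e =
  c * (e + n%:R) * sheppard_rhs n a b (c + 1) e
  + a * b * sheppard_rhs n (a + 1) (b + 1) c (e + 1).
Proof.
rewrite /sheppard_rhs; set v := a + b + c - e.
rewrite (_ : a + b + (c + 1) - e = v + 1); last by rewrite /v; ring.
rewrite (_ : a + 1 + (b + 1) + c - (e + 1) = v + 1); last by rewrite /v; ring.
rewrite (_ : e + 1 - (a + 1) = e - a); last by ring.
pose h k := rising a k * rising (c + a + k%:R) (n.+1 - k)
  * rising (e - a) (n.+1 - k).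
rewrite (eq_bigr (fun k : 'I_n.+2 => 'C(n.+1, k)%:R * (rising v k * h k)));
  last by move=> k _; rewrite /h; ring.
rewrite (sum_bin_pascal n (fun k => rising v k * h k)).
rewrite (eq_bigr (fun k : 'I_n.+1 =>
    'C(n, k)%:R * (rising (v + 1) k * h k + v * rising (v + 1) k * h k.+1)
    - 'C(n, k)%:R * (k%:R * (rising (v + 1) k.-1 * h k)))); last first.
  by move=> k _; rewrite risingSl [rising v k]rising_sub1; ring.
rewrite sumrB (sum_bin_shift n (fun k => rising (v + 1) k.-1 * h k)) -sumrB.
rewrite !big_distrr -big_split /=; apply: eq_bigr => -[k /= lt_kn] _.
have le_kn : (k <= n)%N by [].
rewrite /h subSS subSn // (risingSl (c + a + _)) (risingSr (e - a)).
rewrite (risingSr a) natrB // -natr1.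
rewrite (_ : c + a + (k%:R + 1) = c + a + k%:R + 1); last by ring.
rewrite (_ : c + 1 + a + k%:R = c + a + k%:R + 1); last by ring.
rewrite (_ : c + (a + 1) + k%:R = c + a + k%:R + 1); last by ring.
have aS : a * rising (a + 1) k = rising a k * (a + k%:R).
  by rewrite -risingSl risingSr.
set P := rising (c + a + k%:R + 1) _; set Q := rising (e - a) _.
set V := rising (v + 1) k.
(* Apart from the common factors, the left side is (c+a+k)(e-a+n-k) + (a+k)(v-n+k), which equals
   c(e+n) + b(a+k) because e - a + v = b + c. *)
transitivity ('C(n, k)%:R * V * P * Q *
  (c * (e + n%:R) * rising a k + b * (rising a k * (a + k%:R)))).
  by rewrite (_ : b = v + e - a - c); [ring | rewrite /v; ring].
by rewrite -aS; ring.
Qed.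

Lemma sheppard n a b c e : sheppard_lhs n a b c e = sheppard_rhs n a b c e.
Proof.
elim: n a b c e => [|n IH] a b c e.
  by rewrite /sheppard_lhs /sheppard_rhs !big_ord1 !rising0.
by rewrite sheppard_lhsS sheppard_rhsS !IH.
Qed.

(** For this e the parameter a + b + c - e is -k, so its rising factorial is a signed falling
    factorial of k and cuts the sum off at j = k. The prefactors are absorbed by splitting (c+a)_k
    at j and merging (c+b)_k with (c+b+k)_(n-j); each term is then symmetric in n and k. *)
Lemma sheppard_rhs_natE n k a b c :
  rising (c + a) k * rising (c + b) k
    * sheppard_rhs n a b c (a + b + c + k%:R)
  = \sum_(j < (minn n k).+1) (-1) ^+ j * ('C(n, j) * 'C(k, j) * j`!)%:R
      * rising a j * rising (c + a) j * rising (c + a + j%:R) (n - j)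
      * rising (c + a + j%:R) (k - j) * rising (c + b) (n + k - j).
Proof.
rewrite /sheppard_rhs big_distrr /=.
pose F j : R := (-1) ^+ j * ('C(n, j) * 'C(k, j) * j`!)%:R
  * rising a j * rising (c + a + j%:R) (n - j)
  * (rising (c + a) k * (rising (c + b) k * rising (c + b + k%:R) (n - j))).
rewrite (eq_bigr (fun j : 'I_n.+1 => F j)); last first.
  move=> j _; rewrite /F (_ : a + b + c - _ = - k%:R); last by ring.
  rewrite (_ : a + b + c + _ - a = c + b + k%:R); last by ring.
  by rewrite rising_oppn -bin_ffact !natrM; ring.
have le_min : ((minn n k).+1 <= n.+1)%N by rewrite ltnS geq_minl.
pose G j : R := (-1) ^+ j * ('C(n, j) * 'C(k, j) * j`!)%:R
  * rising a j * rising (c + a) j * rising (c + a + j%:R) (n - j)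
  * rising (c + a + j%:R) (k - j) * rising (c + b) (n + k - j).
rewrite [RHS](big_ord_widen n.+1 G le_min) [RHS]big_mkcond /=.
apply: eq_bigr => -[j /= lt_jn] _; rewrite ltnS leq_min -ltnS lt_jn /=.
case: leqP => [le_jk|lt_kj]; last first.
  by rewrite /F (bin_small lt_kj) muln0 mul0n mulr0 !mul0r.
rewrite /F /G -risingD -{2}(subnKC le_jk) (risingD (c + a)).
by rewrite (addnC n k) addnBA //; ring.
Qed.

Lemma sheppard_symm n k a b c :
  rising (c + a) k * rising (c + b) k
    * sheppard_lhs n a b c (a + b + c + k%:R)
  = rising (c + a) n * rising (c + b) n
    * sheppard_lhs k a b c (a + b + c + n%:R).
Proof.
rewrite !sheppard !sheppard_rhs_natE minnC.
by apply: eq_bigr => j _; rewrite (addnC n k) (mulnC 'C(n, j)); ring.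
Qed.

End RisingFactorial.

Lemma LsumE (F : fieldType) (r y : F) (m u d : nat) :
  (m <= u)%N -> (m <= d)%N ->
  Lsum r y m u d = sheppard_lhs (d - m) r (m%:R + 1 - r) (y + r)
                     (r + (m%:R + 1 - r) + (y + r) + (u - m)%:R).
Proof.
move=> le_mu le_md; rewrite /Lsum /sheppard_lhs big_mkord.
apply: eq_bigr => -[l /= lt_ld] _.
have le_ld : (l <= d - m)%N by [].
rewrite -mulrA; congr (_ * _); rewrite !big_split /= -!mulrA.
rewrite mulrCA; congr (_ * _).
  by apply: eq_bigr => i _; rewrite addrC.
congr (_ * _); first by apply: eq_bigr => i _; ring.
congr (_ * _); rewrite /rising.
  (* These factors decrease in j, so the product is reversed: j = d - m - i turns them into y + r +
     i. *)
  rewrite big_nat_rev /= -{1}(add0n l.+1) big_addn subSS.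
  rewrite !big_nat; apply: eq_bigr => i /andP[_ lt_i].
  rewrite (_ : (l.+1 + (d - m).+1 - (i + l.+1).+1 = d - m - i)%N); last first.
    by rewrite addnC -addSn subnDr subSS.
  have le_i : (i <= d - m)%N by rewrite (leq_trans (ltnW lt_i)) ?leq_subr.
  by rewrite natrB // natrB //; ring.
rewrite -{1}(add0n l.+1) big_addn subSS.
by apply: eq_bigr => i _; rewrite natrB // natrD -natr1; ring.
Qed.

Lemma LdenE (F : fieldType) (r y : F) (m d : nat) :
  Lden r y m d = rising (y + r + r) (d - m)
                 * rising (y + r + (m%:R + 1 - r)) (d - m).
Proof.
rewrite /Lden big_split /= mulrC /rising big_add1 big_add1 /=.
by congr (_ * _); apply: eq_bigr => i _; rewrite -natr1; ring.
Qed.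

Lemma Ltilde_symm (F : fieldType) (r y : F) (m u d : nat) :
  (m <= u)%N -> (m <= d)%N -> Lden r y m d != 0 -> Lden r y m u != 0 ->
  Ltilde r y m u d = Ltilde r y m d u.
Proof.
move=> le_mu le_md nz_d nz_u.
apply/eqP; rewrite /Ltilde eqr_div //; apply/eqP.
by rewrite mulrC [RHS]mulrC !LsumE // !LdenE sheppard_symm.
Qed.

(** Setting the outer variable r to 0 turns every factor into a monic linear polynomial in y, hence
    nonzero. *)
Lemma Lden_ratfun_neq0 (m d : nat) : Lden r_var y_var m d != 0.
Proof.
have nzX (q : rat) : 'X + q%:P != 0 :> {poly rat}.
  by rewrite -size_poly_eq0 size_XaddC.
rewrite /Lden prodf_seq_neq0; apply/allP => i _ /=.
rewrite mulf_neq0 // /r_var /y_var -!(rmorph_nat (@tofrac {poly {poly rat}})).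
  rewrite -!tofracD tofrac_eq0.
  apply: contraNneq (nzX (m + i)%:R) => /(congr1 (horner^~ 0)) /eqP.
  by rewrite !(hornerE, hornerMn) polyC_natr natrD addrA.
rewrite -tofrac1 -tofracM -tofracD -tofracB -tofracD tofrac_eq0.
apply: contraNneq (nzX (i%:R - 1)) => /(congr1 (horner^~ 0)) /eqP.
by rewrite !(hornerE, hornerMn) polyCB polyC_natr addrA.
Qed.

Theorem theorem0p3 (m u d : nat) (hu : (m <= u)%N) (hd : (m <= d)%N) :
  Ltilde r_var y_var m u d = Ltilde r_var y_var m d u
  /\ (forall (F : fieldType) (r y : F),
        [pchar F] =i pred0 ->
        Lden r y m d != 0 -> Lden r y m u != 0 ->
        Ltilde r y m u d = Ltilde r y m d u).
Proof.
split=> [|F r y _]; last exact: Ltilde_symm.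
by apply: Ltilde_symm => //; apply: Lden_ratfun_neq0.
Qed.
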